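(* Let $\mathcal{C}(\mathcal{Z})$ be the discrete cluster category associated to an admissible subset $\mathcal{Z}\subseteq S^1$ with $n$ limit points. For $n\geq 2$ there exist no bounded t-structures in $\mathcal{C}(\mathcal{Z})$.
   Context: **Combinatorial setting.** $\mathbb{K}$ is a field. $S^1$ is the unit circle with anti-clockwise cyclic order: for pairwise distinct $x,y,z\in S^1$, $x<y<z$ means that going anti-clockwise one meets first $x$, then $y$, then $z$; for $m\ge 3$, $x_1<\dots<x_m$ means $x_i<x_{i+1}<x_{i+2}$ for all $i$ (indices modulo $m$). $\mathcal{Z}\subseteq S^1$ is admissible: discrete, infinite, with set of limit points $L(\mathcal{Z})=\overline{\mathcal{Z}}\setminus\mathcal{Z}$ ($\overline{\mathcal{Z}}$ the topological closure) finite of cardinality $n$, every limit point being a two-sided limit point. Each $z\in\mathcal{Z}$ has an immediate successor $z^+$ and predecessor $z^-$ in $\mathcal{Z}$ (anti-clockwise, resp. clockwise neighbour). An arc of $\mathcal{Z}$ is a 2-element subset $\{z_0,z_1\}\subseteq\mathcal{Z}$ with $z_1\notin\{z_0^-,z_0,z_0^+\}$. Arcs $\{y_0,y_1\},\{y_0',y_1'\}$ cross if $y_0<y_0'<y_1<y_1'$ or $y_0<y_1'<y_1<y_0'$. **The category.** $\mathcal{C}(\mathcal{Z})$ is the discrete cluster category of Igusa–Todorov: a $\mathbb{K}$-linear, 2-Calabi–Yau, Krull–Schmidt triangulated category with suspension $\Sigma$ whose non-zero indecomposable objects correspond to arcs of $\mathcal{Z}$ (same notation for arc and object), with: - $\Sigma\{y_0,y_1\}=\{y_0^-,y_1^-\}$;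 - $\mathrm{Hom}(\{y_0,y_1\},\Sigma\{y_0',y_1'\})=\mathbb{K}$ if the arcs $\{y_0,y_1\}$ and $\{y'_0,y'_1\}$ cross, and $0$ otherwise; - a non-zero morphism $\{y_0,y_1\}\to\{y_0',y_1'\}$ with $y_0<y_0'^+<y_1<y_1'^+$ factors through an indecomposable $S$ iff $S=\{s_0,s_1\}$ with $y_0\le s_0\le y_0'$ and $y_1\le s_1\le y_1'$; - if $y_0<y_0'<y_1<y_1'$, every non-zero $f:\{y_0,y_1\}\to\Sigma\{y_0',y_1'\}$ sits in a triangle $\{y_0',y_1'\}\to X\oplus Z\to\{y_0,y_1\}\xrightarrow{f}\Sigma\{y_0',y_1'\}$ with $X=\{y_0,y_0'\}$, $Z=\{y_1,y_1'\}$ (read as $0$ when not an arc); the components of the first two maps to and from $X$, $Z$ are non-zero when the corresponding objects are non-zero. All subcategories are full and closed under direct sums and summands. **t-structures.** A torsion pair in a triangulated category $\mathcal{T}$ is a pair $(\mathcal{X},\mathcal{Y})$ of subcategories closed under direct summands with $\mathrm{Hom}(X,Y)=0$ for $X\in\mathcal{X},Y\in\mathcal{Y}$ and such that every $T\in\mathcal{T}$ has a distinguished triangle $X\to T\to Y\to\Sigma X$ with $X\in\mathcal{X},Y\in\mathcal{Y}$. A t-structure is a torsion pair with $\Sigma\mathcal{X}\subseteq\mathcal{X}$; $\mathcal{X}$ is its aisle, $\mathcal{Y}=\mathcal{X}^\perp$ its coaisle. A t-structure in $\mathcal{C}(\mathcal{Z})$ is bounded above if $\bigcup_{k\in\mathbb{Z}}\Sigma^k\mathcal{X}=\mathcal{C}(\mathcal{Z})$,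 bounded below if $\bigcup_{k\in\mathbb{Z}}\Sigma^k\mathcal{Y}=\mathcal{C}(\mathcal{Z})$, and bounded if it is both bounded above and bounded below. *)

(* Defs.v *)
From HB Require Import structures.
From mathcomp Require Import all_boot all_order all_algebra.
From mathcomp Require Import all_classical all_reals all_analysis.
Set Implicit Arguments.
Unset Strict Implicit.
Unset Printing Implicit Defensive.
Import Order.TTheory GRing.Theory Num.Theory.
Import numFieldNormedType.Exports.
Local Open Scope classical_set_scope.
Local Open Scope ring_scope.

Record linCat (K : fieldType) := LinCat {
  ob :> Type;
  hom : ob -> ob -> lmodType K;
  idm : forall X, hom X X;
  comp : forall X Y Z, hom Y Z -> hom X Y -> hom X Z;
  compA : forall X Y Z W (h : hom Z W) (g : hom Y Z) (f : hom X Y),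
    comp h (comp g f) = comp (comp h g) f;
  comp1m : forall X Y (f : hom X Y), comp (idm Y) f = f;
  compm1 : forall X Y (f : hom X Y), comp f (idm X) = f;
  comp_linearl : forall X Y Z (f : hom X Y) a (g g' : hom Y Z),
    comp (a *: g + g') f = a *: comp g f + comp g' f;
  comp_linearr : forall X Y Z (g : hom Y Z) a (f f' : hom X Y),
    comp g (a *: f + f') = a *: comp g f + comp g f'
}.

Arguments hom {K l}.
Arguments idm {K l}.
Arguments comp {K l X Y Z}.

Declare Scope cat_scope.
Delimit Scope cat_scope with cat.
(* [g \c f] is "g after f". *)
Notation "g '\c' f" := (comp g f) (at level 40, left associativity) : cat_scope.
Local Open Scope cat_scope.

Section LinearCategories.
Context {K : fieldType} {C : linCat K}.
Implicit Types X Y Z A B : C.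

Definition is_isom X Y (f : hom X Y) : Prop :=
  exists g : hom Y X, g \c f = idm X /\ f \c g = idm Y.

Definition isomorphic X Y : Prop := exists f : hom X Y, is_isom f.

Definition is_zero X : Prop :=
  forall Y, (forall f : hom X Y, f = 0) /\ (forall f : hom Y X, f = 0).

Definition is_biproduct A B X (iA : hom A X) (iB : hom B X)
    (pA : hom X A) (pB : hom X B) : Prop :=
  [/\ pA \c iA = idm A, pB \c iB = idm B, pA \c iB = 0, pB \c iA = 0
    & iA \c pA + iB \c pB = idm X].

Definition is_sum A B X : Prop :=
  exists iA iB pA pB, @is_biproduct A B X iA iB pA pB.

Definition is_finite_sum n (F : 'I_n -> C) X : Prop :=
  exists (i : forall k, hom (F k) X) (p : forall k, hom X (F k)),
    [/\ forall k, p k \c i k = idm (F k),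
        forall k l, k != l -> p k \c i l = 0
      & \sum_(k < n) i k \c p k = idm X].

Definition indecomposable X : Prop :=
  ~ is_zero X /\ forall A B, is_sum A B X -> is_zero A \/ is_zero B.

(* A non-zero ring is local iff its non-units are closed under addition. *)
Definition local_end X : Prop :=
  idm X != 0 /\
  forall f g : hom X X, ~ is_isom f -> ~ is_isom g -> ~ is_isom (f + g).

Definition factors_through X Y (f : hom X Y) (S : C) : Prop :=
  exists (g : hom X S) (h : hom S Y), f = h \c g.

(* Full subcategories closed under (possibly empty) finite direct sums and
   under direct summands; they are automatically closed under isomorphism. *)
Definition is_subcat (P : set C) : Prop :=
  [/\ forall X, is_zero X -> P X,
      forall A B X, is_sum A B X -> P A -> P B -> P X
    & forall A B X, is_sum A B X -> P X -> P A].

End LinearCategories.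

Definition additive (K : fieldType) (C : linCat K) : Prop :=
  (exists X : C, is_zero X) /\ (forall A B : C, exists X, is_sum A B X).

Definition krull_schmidt (K : fieldType) (C : linCat K) : Prop :=
  forall X : C, exists n (F : 'I_n -> C),
    (forall k, local_end (F k)) /\ is_finite_sum F X.

(* The suspension is a K-linear autoequivalence, i.e. fully faithful and
   essentially surjective. *)
Record triangCat (K : fieldType) := TriangCat {
  tcat :> linCat K;
  tcat_additive : additive tcat;
  Sg : tcat -> tcat;
  Sgm : forall X Y : tcat, hom X Y -> hom (Sg X) (Sg Y);
  Sgm_id : forall X, Sgm (idm X) = idm (Sg X);
  Sgm_comp : forall X Y Z (g : hom Y Z) (f : hom X Y),
    Sgm (g \c f) = Sgm g \c Sgm f;
  Sgm_linear : forall X Y a (f g : hom X Y),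
    Sgm (a *: f + g) = a *: Sgm f + Sgm g;
  Sgm_bij : forall X Y, bijective (@Sgm X Y);
  Sg_ess_surj : forall X, exists Y, isomorphic (Sg Y) X;
  (* [tri f g h]: X -f-> Y -g-> Z -h-> Sg X is distinguished *)
  tri : forall X Y Z : tcat, hom X Y -> hom Y Z -> hom Z (Sg X) -> Prop;
  tri_isom : forall X Y Z (f : hom X Y) (g : hom Y Z) (h : hom Z (Sg X))
      X' Y' Z' (f' : hom X' Y') (g' : hom Y' Z') (h' : hom Z' (Sg X'))
      (x : hom X X') (y : hom Y Y') (z : hom Z Z'),
    is_isom x -> is_isom y -> is_isom z ->
    y \c f = f' \c x -> z \c g = g' \c y -> Sgm x \c h = h' \c z ->
    tri f g h -> tri f' g' h';
  tri_id : forall X O : tcat, is_zero O ->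
    tri (idm X) (0 : hom X O) (0 : hom O (Sg X));
  tri_ext : forall X Y (f : hom X Y),
    exists Z (g : hom Y Z) (h : hom Z (Sg X)), tri f g h;
  tri_rot : forall X Y Z (f : hom X Y) (g : hom Y Z) (h : hom Z (Sg X)),
    tri f g h <-> tri g h (- Sgm f);
  tri_fill : forall X Y Z (f : hom X Y) (g : hom Y Z) (h : hom Z (Sg X))
      X' Y' Z' (f' : hom X' Y') (g' : hom Y' Z') (h' : hom Z' (Sg X'))
      (x : hom X X') (y : hom Y Y'),
    tri f g h -> tri f' g' h' -> y \c f = f' \c x ->
    exists z : hom Z Z', z \c g = g' \c y /\ Sgm x \c h = h' \c z;
  tri_octahedral : forall X Y Z U V W (f : hom X Y) (g : hom Y Z)
      (a : hom Y U) (a' : hom U (Sg X))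
      (b : hom Z V) (b' : hom V (Sg Y))
      (c : hom Z W) (c' : hom W (Sg X)),
    tri f a a' -> tri g b b' -> tri (g \c f) c c' ->
    exists (u : hom U W) (v : hom W V),
      [/\ tri u v (Sgm a \c b'),
          u \c a = c \c g, c' \c u = a',
          v \c c = b & b' \c v = Sgm f \c c']
}.

Arguments Sg {K t}.
Arguments Sgm {K t X Y}.
Arguments tri {K t X Y Z}.

(* The square of the suspension is a Serre functor: Hom(X, Y) is isomorphic to
   the dual of Hom(Y, Sg^2 X), naturally in X and Y. *)
Definition two_calabi_yau (K : fieldType) (C : triangCat K) : Prop :=
  exists phi : forall X Y : C, hom X Y -> {linear hom Y (Sg (Sg X)) -> K^o},
    [/\ forall X Y a (f f' : hom X Y) g,
          phi X Y (a *: f + f') g = a *: phi X Y f g + phi X Y f' g,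
        forall X Y, bijective (phi X Y),
        forall X Y Y' (f : hom X Y) (u : hom Y Y') (g : hom Y' (Sg (Sg X))),
          phi X Y' (u \c f) g = phi X Y f (g \c u)
      & forall X' X Y (f : hom X Y) (v : hom X' X) (g : hom Y (Sg (Sg X'))),
          phi X' Y (f \c v) g = phi X Y f (Sgm (Sgm v) \c g)].

Section TStructures.
Context {K : fieldType} {C : triangCat K}.

(* The (isomorphism closed) subcategory Sg^k P. *)
Definition suspend (k : int) (P : set C) : set C :=
  match k with
  | Posz m => [set T | exists2 X, P X & isomorphic (iter m Sg X) T]
  | Negz m => [set T | P (iter m.+1 Sg T)]
  end.

Definition torsion_pair (X Y : set C) : Prop :=
  [/\ is_subcat X, is_subcat Y,
      forall A B, X A -> Y B -> forall f : hom A B, f = 0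
    & forall T, exists A B (f : hom A T) (g : hom T B) (h : hom B (Sg A)),
        [/\ X A, Y B & tri f g h]].

Definition t_structure (X Y : set C) : Prop :=
  torsion_pair X Y /\ forall A, X A -> X (Sg A).

Definition bounded_above (X : set C) : Prop :=
  \bigcup_(k in [set: int]) suspend k X = [set: C].

Definition bounded_below (Y : set C) : Prop :=
  \bigcup_(k in [set: int]) suspend k Y = [set: C].

Definition bounded_t_structure (X Y : set C) : Prop :=
  [/\ t_structure X Y, bounded_above X & bounded_below Y].

End TStructures.

Section Circle.
Context {R : realType}.
Local Notation pt := (R * R)%type.
Implicit Types (x y z : pt) (Z : set pt).

Definition circle : set pt := [set p | p.1 ^+ 2 + p.2 ^+ 2 = 1].

Definition cis (t : R) : pt := (cos t, sin t).

(* The anti-clockwise cyclic order x < y < z. *)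
Definition cyc x y z : Prop :=
  exists a b c : R, [/\ x = cis a, y = cis b, z = cis c
    & [/\ a < b, b < c & c < a + pi *+ 2]].

Definition cyc4 x y z w : Prop :=
  [/\ cyc x y z, cyc y z w, cyc z w x & cyc w x y].

(* x <= s <= y: s is on the closed anti-clockwise arc from x to y, which is
   the single point x when x = y. *)
Definition cyc_le x s y : Prop := [\/ s = x, s = y | cyc x s y].

Definition limits Z : set pt := closure Z `\` Z.

Definition two_sided Z (p : pt) : Prop :=
  forall t, p = cis t -> forall e, 0 < e ->
    (exists2 s, t < s < t + e & Z (cis s)) /\
    (exists2 s, t - e < s < t & Z (cis s)).

Definition admissible Z (n : nat) : Prop :=
  [/\ Z `<=` circle, Z `<=` isolated Z, infinite_set Z,
      (limits Z #= `I_n)%card & limits Z `<=` two_sided Z].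

(* Immediate anti-clockwise and clockwise neighbours; both exist and are unique
   when Z is admissible and z is in Z. *)
Definition nxt Z z : pt :=
  xget z [set w | [/\ Z w, w <> z & forall y, Z y -> ~ cyc z y w]].
Definition prv Z z : pt :=
  xget z [set w | [/\ Z w, w <> z & forall y, Z y -> ~ cyc w y z]].

Definition arc Z (A : set pt) : Prop :=
  exists z0 z1, [/\ Z z0, Z z1, A = [set z0; z1]
    & [/\ z1 <> prv Z z0, z1 <> z0 & z1 <> nxt Z z0]].

Definition cross y0 y1 y0' y1' : Prop :=
  cyc4 y0 y0' y1 y1' \/ cyc4 y0 y1' y1 y0'.

End Circle.

Section Cluster.
Context {R : realType} {K : fieldType} (Z : set (R * R)) (C : triangCat K).
Variable M : set (R * R) -> C.
Local Notation nx := (nxt Z).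
Local Notation pv := (prv Z).

(* M sends an arc to the corresponding indecomposable object, and every other
   set of points to a zero object. *)
Definition arc_indecomposables : Prop :=
  [/\ forall A, arc Z A -> indecomposable (M A),
      forall A, ~ arc Z A -> is_zero (M A),
      forall X, indecomposable X -> exists2 A, arc Z A & isomorphic (M A) X
    & forall A B, arc Z A -> arc Z B -> isomorphic (M A) (M B) -> A = B].

Definition arc_suspension : Prop := forall y0 y1, arc Z [set y0; y1] ->
  isomorphic (Sg (M [set y0; y1])) (M [set pv y0; pv y1]).

Definition arc_homs : Prop := forall y0 y1 y0' y1',
  arc Z [set y0; y1] -> arc Z [set y0'; y1'] ->
  let H := hom (M [set y0; y1]) (Sg (M [set y0'; y1'])) in
  (cross y0 y1 y0' y1' -> exists phi : {linear K^o -> H}, bijective phi) /\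
  (~ cross y0 y1 y0' y1' -> forall f : H, f = 0).

Definition arc_factorizations : Prop := forall y0 y1 y0' y1',
  arc Z [set y0; y1] -> arc Z [set y0'; y1'] ->
  cyc4 y0 (nx y0') y1 (nx y1') ->
  forall f : hom (M [set y0; y1]) (M [set y0'; y1']), f != 0 ->
  forall S : C, indecomposable S ->
  (factors_through f S <->
   exists s0 s1, [/\ Z s0, Z s1, isomorphic S (M [set s0; s1]),
     cyc_le y0 s0 y0' & cyc_le y1 s1 y1']).

Definition arc_triangles : Prop := forall y0 y1 y0' y1',
  arc Z [set y0; y1] -> arc Z [set y0'; y1'] ->
  cyc4 y0 y0' y1 y1' ->
  forall f : hom (M [set y0; y1]) (Sg (M [set y0'; y1'])), f != 0 ->
  let X1 := [set y0; y0'] in let X2 := [set y1; y1'] in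
  exists (B : C) (i1 : hom (M X1) B) (i2 : hom (M X2) B)
    (p1 : hom B (M X1)) (p2 : hom B (M X2))
    (u : hom (M [set y0'; y1']) B) (v : hom B (M [set y0; y1])),
  [/\ is_biproduct i1 i2 p1 p2, tri u v f,
      arc Z X1 -> p1 \c u != 0 /\ v \c i1 != 0
    & arc Z X2 -> p2 \c u != 0 /\ v \c i2 != 0].

End Cluster.

(* The discrete cluster category of Z is specified by its structure and the
   description of its indecomposables, not by an explicit construction; M is the
   labelling of the indecomposables by arcs. *)
Definition discrete_cluster_category (R : realType) (K : fieldType)
    (Z : set (R * R)) (C : triangCat K) (M : set (R * R) -> C) : Prop :=
  two_calabi_yau C /\ krull_schmidt C /\
  [/\ arc_indecomposables Z M, arc_suspension Z M, arc_homs Z M,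
      arc_factorizations Z M & arc_triangles Z M].

(* Main.v *)
(* Choose limit points p, q and an arc {a, b} whose endpoints are separated by
   them: q < a < p < b < q.  The predecessor map never leaves the segment
   between two limit points, so Sigma^k {a, b} = {a^(-k), b^(-k)} satisfies
   q < a^(-k) < a < p < b^(-k) < b for all k >= 1; hence Sigma^(k+1) {a, b} and
   {a, b} cross and Hom(Sigma^k A, A) <> 0 for A = {a, b} and all k >= 0.
   A bounded t-structure would put high suspensions of A in the aisle and high
   desuspensions in the coaisle, forcing these groups to vanish for large k. *)
From mathcomp Require Import all_boot all_order all_algebra.
From mathcomp Require Import all_classical all_reals all_analysis.
From mathcomp Require Import ring lra.
Require Import Defs.
Set Implicit Arguments.
Unset Strict Implicit.
Unset Printing Implicit Defensive.
Import Order.TTheory GRing.Theory Num.Theory.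
Import numFieldNormedType.Exports.
Local Open Scope ring_scope.
Local Open Scope classical_set_scope.

(** * Angles as lifts of points of the circle, and the cyclic order *)

Section CircleGeometry.
Context {R : realType}.
Local Notation pt := (R * R)%type.
Local Notation tau := (pi *+ 2 : R).
Implicit Types (p : pt) (s t : R).

Lemma tau_gt0 : 0 < tau.
Proof. by rewrite mulrn_wgt0 ?pi_gt0. Qed.

Lemma cis_period t : cis (t + tau) = cis t.
Proof. by rewrite /cis sinD2pi cosD2pi. Qed.

Lemma cis_congrD a b c : cis a = cis b -> cis (a + c) = cis (b + c) :> pt.
Proof. by move=> [ec es]; rewrite /cis !sinD !cosD ec es. Qed.

(** Half-angle argument: cos (b - a) = 1 - 2 sin^2 ((b - a) / 2), and half the difference lies in
    (0, pi), where the sine is positive. *)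
Lemma cis_neq a b : a < b -> b < a + tau -> cis a <> cis b :> pt.
Proof.
move=> ab ba /(cis_congrD (- a)); rewrite subrr => -[+ _].
set x := (b - a) / 2; have -> : b - a = x *+ 2 by rewrite /x mulr2n; lra.
rewrite cos0 cos_mulr2n cos2sin2.
have s0 : 0 < sin x.
  by apply: sin_gt0_pi; rewrite /x mulr2n in ba *; apply/andP; split; lra.
have : 0 < sin x ^+ 2 by rewrite exprn_gt0.
by rewrite mulr2n; lra.
Qed.

Lemma cis_inj_lt a b : `|a - b| < tau -> cis a = cis b :> pt -> a = b.
Proof.
rewrite ltr_norml => /andP[h1 h2] e; case: (ltgtP a b) => // ab; exfalso.
  by apply: (cis_neq ab _ e); lra.
by apply: (cis_neq ab _ (esym e)); lra.
Qed.

(** For y > 0 the angle is acos x; for y <= 0 it is its reflection [- acos x + tau], so that (1, 0)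
    gets the angle [tau]. *)
Lemma circle_cis0 p : circle p -> exists t, [/\ 0 < t, t <= tau & p = cis t].
Proof.
case: p => x y; rewrite /circle /= => xy.
have y0 := sqr_ge0 y.
have hx : -1 <= x <= 1 by apply/andP; split; nra.
have [/andP[a0 api] ca] := acos_def hx.
have := sin_acos hx; have -> : 1 - x ^+ 2 = y ^+ 2 by lra.
rewrite sqrtr_sqr => sa.
have tau2 : tau = pi + pi by rewrite mulr2n.
have [yp|yn] := ltP 0 y.
  exists (acos x); split; last by rewrite /cis ca sa gtr0_norm.
    rewrite lt_neqAle a0 andbT; apply/eqP => e.
    by move: sa; rewrite -e sin0 gtr0_norm //; lra.
  by rewrite tau2; lra.
exists (- acos x + tau); split.
- by rewrite tau2; have := pi_gt0 R; lra.
- by lra.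
- by rewrite cis_period /cis cosN sinN ca sa ler0_norm // opprK.
Qed.

Lemma circle_cis t p : circle p -> exists s, [/\ t < s, s <= t + tau & p = cis s].
Proof.
case: p => x y; rewrite /circle /= => xy.
have ct := cos2Dsin2 t.
(* The point p rotated by -t, which reduces the window (t, t + tau] to (0, tau]. *)
pose q := (x * cos t + y * sin t, y * cos t - x * sin t).
have cq : circle q.
  by rewrite /circle /=; rewrite -[RHS]mulr1 -{1}xy -ct; ring.
have [s [s0 s1 qs]] := circle_cis0 cq.
exists (t + s); split; [lra|lra|].
move: qs; rewrite /q /cis => -[ec es]; rewrite cosD sinD -ec -es.
by congr pair; rewrite -[LHS]mulr1 -ct; ring.
Qed.

Lemma cyc_cis a b c : a < b -> b < c -> c < a + tau -> cyc (cis a) (cis b) (cis c).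
Proof. by move=> *; exists a, b, c. Qed.

(** [cyc] only provides some lifts a', b', c'. Both c' - a' and c - a lie in (0, tau) and have the
    same image under [cis], so they agree; translating b' by a - a' puts it between a and c. *)
Lemma cyc_lift a c y : a < c -> c < a + tau -> cyc (cis a) y (cis c) ->
  exists b, [/\ a < b, b < c & y = cis b].
Proof.
move=> ac ca [a' [b' [c' [ea -> ec [ab bc ca']]]]].
have ec0 : c' - a' = c - a.
  apply: cis_inj_lt; first by rewrite ltr_norml; apply/andP; split; lra.
  rewrite -(cis_congrD (- a') ec).
  have := cis_congrD (c - a - a') ea.
  have -> : a + (c - a - a') = c - a' by ring.
  by have -> : a' + (c - a - a') = c - a by ring.
exists (b' - a' + a); split; [lra|lra|].
by rewrite [_ + a]addrC (cis_congrD (b' - a') ea) addrC subrK.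
Qed.

Lemma continuous_cis : continuous (@cis R).
Proof.
by move=> t; exact: (cvg_pair (@continuous_cos R t) (@continuous_sin R t)).
Qed.

Lemma closed_circle : closed (@circle R).
Proof.
pose f (p : pt) := p.1 ^+ 2 + p.2 ^+ 2.
rewrite (_ : circle = f @^-1` [set x | x = 1]) //.
apply: preimage_closed; last exact: closed_eq.
move=> p _.
apply: cvgD.
  apply: (@cvg_comp _ _ _ fst (fun x => x ^+ 2));
    [exact: cvg_fst|exact: exprn_continuous].
apply: (@cvg_comp _ _ _ snd (fun x => x ^+ 2));
    [exact: cvg_snd|exact: exprn_continuous].
Qed.

Lemma near_cis s (V : set pt) : nbhs (cis s) V ->
  exists2 e, 0 < e & forall u, `|s - u| < e -> V (cis u).
Proof.
by move=> /continuous_cis /nbhs_ballP [e /= e0 h]; exists e.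
Qed.

(** * Predecessors in an admissible set, and an arc crossing all its predecessor shifts *)

Section Admissible.
Variables (Z : set pt) (n : nat).
Hypothesis Zadm : admissible Z n.

Lemma admissible_sub_circle : Z `<=` circle.
Proof. by case: Zadm. Qed.

Lemma limits_circle : limits Z `<=` circle.
Proof.
move=> p [/(closureS admissible_sub_circle)].
by rewrite -(closure_id _).1 //; exact: closed_circle.
Qed.

Lemma limit_right t e : limits Z (cis t) -> 0 < e -> exists2 s, t < s < t + e & Z (cis s).
Proof. by case: Zadm => _ _ _ _ h /h /(_ t erefl e) h' /h' []. Qed.

Lemma isolated_left s : Z (cis s) ->
  exists2 e, 0 < e & forall u, s - e < u -> u < s -> ~ Z (cis u).
Proof.
case: Zadm => _ h _ _ _ /h [_ [V /near_cis [e e0 eV] VZ]].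
(* The bound by [tau] keeps u within one turn of s, so that [cis u] and [cis s] differ. *)
exists (Order.min e tau); first by rewrite lt_min e0 tau_gt0.
move=> u su us Zu.
have [ue ut] : s - e < u /\ s - tau < u.
  have : s - u < Order.min e tau by lra.
  by rewrite lt_min => /andP[? ?]; split; lra.
suff : [set cis s] (cis u) by apply: cis_neq => //; lra.
by rewrite -VZ; split => //; apply: eV; rewrite gtr0_norm; lra.
Qed.

(** The predecessor is the supremum m of the angles of points of Z in (t, s). Isolation of [cis s]
    gives m < s. If m were not attained, [cis m] would be a limit point, and points of Z would also
    accumulate at m from the right, above the supremum. *)
Lemma ex_pred t s : limits Z (cis t) -> Z (cis s) -> t < s ->
  exists u, [/\ t < u, u < s, Z (cis u) & forall v, u < v -> v < s -> ~ Z (cis v)].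
Proof.
move=> Lt Zs ts; pose E := [set u | [/\ t < u, u < s & Z (cis u)]].
have st0 : 0 < s - t by lra.
have [v0 /andP[tv vs] Zv] := limit_right Lt st0.
have Ev : E v0 by split => //; lra.
have ubE : ubound E s by move=> u [_ /ltW].
have hE : has_sup E by split; [exists v0|exists s].
pose m := sup E.
have mle : m <= s by apply: ge_sup; [exists v0|].
have vm : v0 <= m by apply: ub_le_sup; [exists s|].
have nobetween v : m < v -> v < s -> ~ Z (cis v).
  move=> mv vs' Zv'; suff : v <= m by lra.
  by apply: ub_le_sup; [exists s|split => //; lra].
have ms : m < s.
  rewrite lt_neqAle mle andbT; apply/eqP => em.
  have [e e0 he] := isolated_left Zs.
  have [u [tu us Zu]] := sup_adherent e0 hE.
  by rewrite -/m em => su; apply: (he u).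
exists m; split => //; first lra.
apply: contrapT => nZm.
have Lm : limits Z (cis m).
  split => // V /near_cis [e e0 eV].
  have [u Eu] := sup_adherent e0 hE; rewrite -/m => mu.
  have um : u <= m by apply: ub_le_sup => //; exists s.
  exists (cis u); case: Eu => _ _ Zu; split => //.
  by apply: eV; rewrite ger0_norm; lra.
have sm0 : 0 < s - m by lra.
have [w /andP[mw ws] Zw] := limit_right Lm sm0.
by apply: (nobetween w) => //; lra.
Qed.

(** The limit point at t is a barrier: if the chosen predecessor had its lift in [s, t + tau], the
    point u of Z would lie strictly between it and [cis s]. *)
Lemma prv_between t s : limits Z (cis t) -> Z (cis s) -> t < s -> s < t + tau ->
  exists u, [/\ t < u, u < s, prv Z (cis s) = cis u & Z (cis u)].
Proof.
move=> Lt Zs ts st.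
have [u [tu us Zu hu]] := ex_pred Lt Zs ts.
(* The default value of [xget] is ruled out, since [cis u] itself qualifies as a predecessor. *)
rewrite /prv; case: xgetP => [w _ [Zw ws hw]|/(_ (cis u)) []]; last first.
  split => //; first by apply: cis_neq => //; lra.
  move=> y Zy /cyc_lift [//||b [ub bs yb]]; first by lra.
  by apply: (hu b) => //; rewrite -yb.
have [v [tv vt ewv]] := circle_cis t (admissible_sub_circle Zw).
subst w; exists v; split => //.
rewrite ltNge; apply/negP => sv.
have {}sv : s < v by rewrite lt_neqAle sv andbT; apply/eqP => e; apply: ws; rewrite e.
apply: (hw (cis u)) => //.
(* Going back one turn gives lifts in the order v - tau < u < s. *)
have -> : cis v = cis (v - tau) :> pt by rewrite -[in RHS]cis_period subrK.
by apply: cyc_cis; lra.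
Qed.

Lemma iter_prv_between t s k : limits Z (cis t) -> Z (cis s) -> t < s -> s < t + tau ->
  exists u, [/\ t < u, u < s, iter k.+1 (prv Z) (cis s) = cis u & Z (cis u)].
Proof.
move=> Lt; elim: k s => [|k IH] s Zs ts st; first exact: prv_between.
have [u [tu us eu Zu]] := prv_between Lt Zs ts st.
have [v [tv vu ev Zv]] := IH _ Zu tu (lt_trans us st).
by exists v; rewrite iterSr eu; split => //; lra.
Qed.

Lemma ex_two_limits : (2 <= n)%N ->
  exists t s, [/\ t < s, s < t + tau, limits Z (cis t) & limits Z (cis s)].
Proof.
move=> n2; have n1 := ltnW n2.
case: Zadm => _ _ _ /card_esym /card_set_bijP [f [fL finj _]] _.
have [Lp Lq] : limits Z (f 0%N) /\ limits Z (f 1%N).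
  by split; apply: fL.
have pq : f 0%N <> f 1%N.
  by move/finj; rewrite !in_setE => /(_ n1 n2).
have [t [_ _ ep]] := circle_cis 0 (limits_circle Lp).
have [s [ts st eq]] := circle_cis t (limits_circle Lq).
exists t, s; rewrite -ep -eq; split => //.
rewrite lt_neqAle st andbT; apply/eqP => e.
by apply: pq; rewrite ep eq e cis_period.
Qed.

(** Limit points at t < s < t + tau, with a in (t, s) and b in (s, t + tau). Iterated predecessors u
    of a and v of b stay beyond their barriers t and s, whence u < a < v < b < u + tau. *)
Lemma ex_persistent_arc : (2 <= n)%N -> exists a b, arc Z [set a; b] /\
  forall k, cross (iter k.+1 (prv Z) a) (iter k.+1 (prv Z) b) a b.
Proof.
move=> /ex_two_limits [t [s [ts st Lt Ls]]].
have [e1 e2] : 0 < s - t /\ 0 < t + tau - s by lra.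
have [a /andP[ta as'] Za] := limit_right Lt e1.
have [b /andP[sb bt] Zb] := limit_right Ls e2.
exists (cis a), (cis b); split.
  exists (cis a), (cis b); split => //; split.
  (* The default of [xget] is [cis a], distinct from [cis b]. Otherwise a point of Z just after the
     limit point t separates b from a; for [nxt], a point just after s does the same. *)
  - rewrite /prv; case: xgetP => [w ew [_ _ h] eb|_]; last by apply/nesym/cis_neq; lra.
    have e3 : 0 < a - t by lra.
    have [v /andP[tv va] Zv] := limit_right Lt e3.
    apply: (h (cis v)) => //; rewrite -eb -(cis_period v) -(cis_period a).
    by apply: cyc_cis; lra.
  - by apply/nesym/cis_neq; lra.
  - rewrite /nxt; case: xgetP => [w ew [_ _ h] eb|_]; last by apply/nesym/cis_neq; lra.
    have e3 : 0 < b - s by lra.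
    have [v /andP[tv va] Zv] := limit_right Ls e3.
    by apply: (h (cis v)) => //; rewrite -eb; apply: cyc_cis; lra.
move=> k.
have [u [tu ua -> _]] := iter_prv_between k Lt Za ta ltac:(lra).
have [v [sv vb -> _]] := iter_prv_between k Ls Zb sb ltac:(lra).
left; split.
- by apply: cyc_cis; lra.
- by apply: cyc_cis; lra.
- by rewrite -(cis_period u); apply: cyc_cis; lra.
- by rewrite -(cis_period u) -(cis_period a); apply: cyc_cis; lra.
Qed.

End Admissible.
End CircleGeometry.

(** * Vanishing of morphisms under suspension, isomorphism and bounded t-structures *)

Section TriangulatedCategories.
Context {K : fieldType} {C : triangCat K}.
Local Open Scope cat_scope.
Implicit Types A B T : C.

Lemma compm0 A B T (g : hom B T) : g \c (0 : hom A B) = 0.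
Proof.
have := @comp_linearr _ C _ _ _ g (-1) (0 : hom A B) 0.
by rewrite scaler0 addr0 scaleN1r addNr.
Qed.

Lemma comp0m A B T (f : hom A B) : (0 : hom B T) \c f = 0.
Proof.
have := @comp_linearl _ C _ _ _ f (-1) (0 : hom B T) 0.
by rewrite scaler0 addr0 scaleN1r addNr.
Qed.

Lemma Sgm0 A B : Sgm (0 : hom A B) = 0.
Proof.
have := @Sgm_linear _ C _ _ (-1) (0 : hom A B) 0.
by rewrite scaler0 addr0 scaleN1r addNr.
Qed.

Definition hom_zero A B := forall f : hom A B, f = 0.

Lemma hom_zero_Sg A B : hom_zero (Sg A) (Sg B) <-> hom_zero A B.
Proof.
split=> h f.
  have /bij_inj inj := @Sgm_bij _ C A B.
  by apply: inj; rewrite Sgm0; apply: h.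
by have [g _ gK] := @Sgm_bij _ C A B; rewrite -(gK f) (h (g f)) Sgm0.
Qed.

Lemma hom_zero_iter_Sg k A B :
  hom_zero (iter k Sg A) (iter k Sg B) <-> hom_zero A B.
Proof. by elim: k => //= k IH; rewrite hom_zero_Sg. Qed.

Lemma hom_zero_isol A A' B : isomorphic A A' -> hom_zero A B -> hom_zero A' B.
Proof.
move=> [f [g [_ fg]]] h u.
by rewrite -[u]compm1 -fg compA (h (u \c f)) comp0m.
Qed.

Lemma hom_zero_isor A B B' : isomorphic B B' -> hom_zero A B -> hom_zero A B'.
Proof.
move=> [f [g [_ fg]]] h u.
by rewrite -[u]comp1m -fg -compA (h (g \c u)) compm0.
Qed.

Lemma isomorphic_trans A B T : isomorphic A B -> isomorphic B T -> isomorphic A T.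
Proof.
move=> [f [g [gf fg]]] [f' [g' [gf' fg']]]; exists (f' \c f), (g \c g'); split.
  by rewrite compA -[_ \c f']compA gf' compm1.
by rewrite compA -[_ \c g]compA fg compm1.
Qed.

Lemma isomorphic_sym A B : isomorphic A B -> isomorphic B A.
Proof. by move=> [f [g [gf fg]]]; exists g, f. Qed.

Lemma isomorphic_Sg A B : isomorphic A B -> isomorphic (Sg A) (Sg B).
Proof.
by move=> [f [g [gf fg]]]; exists (Sgm f), (Sgm g); rewrite -!Sgm_comp gf fg !Sgm_id.
Qed.

Lemma is_zero_iso A B : isomorphic A B -> is_zero A -> is_zero B.
Proof.
move=> AB h T; have [h1 h2] := h T; split.
  exact: (hom_zero_isol AB).
exact: (hom_zero_isor AB).
Qed.

Lemma is_zero_Sg A : is_zero (Sg A) -> is_zero A.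
Proof.
by move=> h T; split; apply/hom_zero_Sg; [case: (h (Sg T))|case: (h (Sg T))].
Qed.

(** Boundedness above puts some suspension of A in the aisle, and all later ones follow. Boundedness
    below places A, up to a shift, in the coaisle; applying a common power of [Sg] to both arguments
    reduces to Hom(X, Y) = 0. *)
Lemma bounded_hom_vanish (X Y : set C) A : bounded_t_structure X Y ->
  exists k, hom_zero (iter k Sg A) A.
Proof.
move=> [[[subX subY XY _] SX] bX bY].
have subiso : forall P : set C, is_subcat P ->
    forall T T', isomorphic T T' -> P T -> P T'.
  move=> P [Pzero Psum _] T T' [f [g [gf fg]]] PT.
  have [N zN] := (tcat_additive C).1.
  (* T' is a biproduct of T and a zero object, so closure under sums yields closure under
     isomorphism. *)
  apply: (Psum T N) => //; last exact: Pzero.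
  exists f, 0, g, 0; split => //; rewrite ?compm0 ?comp0m //.
  - by rewrite ((zN N).1 (idm N)).
  - by rewrite fg addr0.
have SXn k T : X T -> X (iter k Sg T) by elim: k => //= k IH /IH /SX.
have [k XkA] : exists k, X (iter k Sg A).
  have : [set: C] A by []. rewrite -bX => -[[m|m] _ /=].
    by move=> [T XT iT]; exists 0%N; exact: (subiso X subX _ _ iT (SXn _ _ XT)).
  by exists m.+1.
have : [set: C] A by []. rewrite -bY => -[[m|m] _ /=].
  (* Here A is the m-th suspension of D in Y, so the m extra suspensions on the left cancel those on
     D. *)
  move=> [D YD iD]; exists (m + k)%N; apply: (hom_zero_isor iD).
  by rewrite iterD; apply/hom_zero_iter_Sg; exact: XY.
(* Here the (m+1)-st suspension of A lies in Y, so both arguments are suspended m+1 times. *)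
move=> YA; exists k; apply/(hom_zero_iter_Sg m.+1).
exact: XY (SXn m.+1 _ XkA) YA.
Qed.

End TriangulatedCategories.

(** * Suspensions of arcs and non-vanishing morphisms in the cluster category *)

Section ClusterCategory.
Context {R : realType} {K : fieldType} (Z : set (R * R)%type) (C : triangCat K).
Variable M : set (R * R)%type -> C.
Hypothesis CZ : discrete_cluster_category Z M.

(** Non-arcs label zero objects, whereas the suspension of a non-zero object is non-zero. *)
Lemma arc_prv a b : arc Z [set a; b] -> arc Z [set prv Z a; prv Z b].
Proof.
case: CZ => _ [_ [[indec zero _ _] susp _ _ _]] ab; apply: contrapT => /zero z.
have [nz _] := indec _ ab; apply: nz; apply: is_zero_Sg.
by apply: is_zero_iso z; apply: isomorphic_sym; exact: susp.
Qed.

Lemma iter_Sg_arc k a b : arc Z [set a; b] ->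
  let A := [set iter k (prv Z) a; iter k (prv Z) b] in
  arc Z A /\ isomorphic (iter k Sg (M [set a; b])) (M A).
Proof.
move=> ab; elim: k => [|k /= [kab iso]].
  by split => //; exists (idm _), (idm _); rewrite comp1m.
split; first exact: arc_prv.
case: CZ => _ [_ [_ susp _ _ _]].
by apply: isomorphic_trans (susp _ _ kab); exact: isomorphic_Sg.
Qed.

(** The crossing rule concerns Hom into a suspension, so both arguments are suspended once more;
    this is why k+1 predecessors go with k suspensions. *)
Lemma hom_iter_Sg_arc_neq0 k a b : arc Z [set a; b] ->
  cross (iter k.+1 (prv Z) a) (iter k.+1 (prv Z) b) a b ->
  ~ hom_zero (iter k Sg (M [set a; b])) (M [set a; b]).
Proof.
move=> ab kab /hom_zero_Sg h.
have [arck iso] := iter_Sg_arc k.+1 ab.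
case: CZ => _ [_ [_ _ homs _ _]].
have [/(_ kab) [phi phi_bij] _] := homs _ _ _ _ arck ab.
(* The image of 1 under the bijective linear map from K is a non-zero morphism. *)
have := hom_zero_isol iso h (phi 1).
rewrite -(linear0 phi) => /(bij_inj phi_bij) /eqP.
by rewrite oner_eq0.
Qed.

End ClusterCategory.

Theorem corollary4p22 (R : realType) (K : fieldType) (Z : set (R * R)%type)
    (n : nat) (C : triangCat K) (M : set (R * R)%type -> C) :
  (2 <= n)%N -> admissible Z n -> discrete_cluster_category Z M ->
  ~ exists X Y : set C, bounded_t_structure X Y.
Proof.
move=> n2 Zadm CZ [X [Y bXY]].
have [a [b [ab crossing]]] := ex_persistent_arc Zadm n2.
have [k] := bounded_hom_vanish (M [set a; b]) bXY.
exact: (hom_iter_Sg_arc_neq0 CZ ab (crossing k)).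
Qed.
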